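(* Every $\mathfrak{a}$-compact space is $\mathfrak{a}$-limit point compact. That is, if $(X,\tau,\mathfrak{a})$ is an $\mathfrak{a}$-space and $X$ is $\mathfrak{a}$-compact, then every infinite subset of $X$ has an $\mathfrak{a}$-limit point in $X$.
   Context: An aura topological space (or $\mathfrak{a}$-space) $(X,\tau,\mathfrak{a})$ is a topological space $(X,\tau)$ together with a function $\mathfrak{a}:X\to\tau$ (a scope function) such that $x\in\mathfrak{a}(x)$ for every $x\in X$. A subset $A\subseteq X$ is $\mathfrak{a}$-open if $\mathfrak{a}(x)\subseteq A$ for every $x\in A$; the collection $\tau_{\mathfrak{a}}$ of all $\mathfrak{a}$-open sets is a topology on $X$ with $\tau_{\mathfrak{a}}\subseteq\tau$. The space $X$ is $\mathfrak{a}$-compact if every cover of $X$ by members of $\tau_{\mathfrak{a}}$ has a finite subcover. A point $x\in X$ is an $\mathfrak{a}$-limit point of $A\subseteq X$ if $\mathfrak{a}(x)\cap(A\setminus\{x\})\neq\emptyset$. The space is $\mathfrak{a}$-limit point compact if every infinite subset of $X$ has an $\mathfrak{a}$-limit point in $X$. *)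

(* Defs.v *)
From HB Require Import structures.
From mathcomp Require Import all_boot all_order all_algebra.
From mathcomp Require Import all_classical.
From mathcomp Require Import topology.

Set Implicit Arguments.
Unset Strict Implicit.
Unset Printing Implicit Defensive.

Local Open Scope classical_set_scope.

Record scope_function (X : topologicalType) := ScopeFunction {
  scope :> X -> set X ;
  scope_open : forall x, open (scope x) ;
  scope_mem : forall x, scope x x
}.

Section Aura.
Variables (X : topologicalType) (a : scope_function X).
Implicit Types (A : set X) (x : X).

Definition aura_open : set (set X) := [set A | forall x, A x -> a x `<=` A].

Definition aura_compact : Prop :=
  forall C : set (set X), C `<=` aura_open -> \bigcup_(U in C) U = setT ->
    exists D : set (set X),
      [/\ D `<=` C, finite_set D & \bigcup_(U in D) U = setT].

(* The limit point x is not required to belong to A. *)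
Definition aura_limit_point A x : Prop := a x `&` (A `\ x) !=set0.

Definition aura_limit_point_compact : Prop :=
  forall A, infinite_set A -> exists x, aura_limit_point A x.

(* aura_open is a topology on X, coarser than the given one. *)
Lemma aura_openT : aura_open setT.
Proof. by move=> x _ y. Qed.

Lemma aura_openI A B : aura_open A -> aura_open B -> aura_open (A `&` B).
Proof. by move=> oA oB x [Ax Bx] y axy; split; [exact: oA axy|exact: oB axy]. Qed.

Lemma aura_open_bigcup (I : Type) (D : set I) (F : I -> set X) :
  (forall i, D i -> aura_open (F i)) -> aura_open (\bigcup_(i in D) F i).
Proof.
by move=> oF x [i Di Fix] y axy; exists i => //; exact: (oF i Di x Fix y axy).
Qed.

Lemma aura_open_open A : aura_open A -> open A.
Proof.
move=> oA; suff -> : A = \bigcup_(x in A) a x.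
  by apply: bigcup_open => x _; exact: scope_open.
apply/seteqP; split=> [x Ax|y [x Ax axy]]; last exact: oA axy.
by exists x => //; exact: scope_mem.
Qed.

End Aura.

(* Main.v *)
(* If A has no a-limit point, then for every x the complement of A \ x is
   a-open and meets A in at most x.  These sets cover X, and a finite subcover
   splits A into finitely many sets with at most one point. *)
Require Import Defs.
From mathcomp Require Import all_boot all_order all_algebra.
From mathcomp Require Import all_classical.
From mathcomp Require Import topology.

Local Open Scope classical_set_scope.

(** If [y] is outside [B], a point of [B] in [a y] differs from [y] and lies in [A], so it would
    make [y] a limit point of [A]. *)
Lemma aura_open_setC_no_limit_point (X : topologicalType)
    (a : scope_function X) (A B : set X) :
  (forall x, ~ aura_limit_point a A x) -> B `<=` A -> aura_open a (~` B).
Proof.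
move=> nlA BA y nBy z ayz Bz; apply: (nlA y); exists z; split=> //.
by split; [exact: BA|move=> zy; apply: nBy; rewrite -zy].
Qed.

Theorem theorem3p14 (X : topologicalType) (a : scope_function X) :
  aura_compact a -> aura_limit_point_compact a.
Proof.
move=> cX A infA; apply: contrapT => /forallNP nlA; apply: infA.
have [||D [DC finD DT]] := cX (range (fun x => ~` (A `\ x))).
- move=> _ [x _ <-]; apply: (aura_open_setC_no_limit_point _ _ _ _ nlA).
  exact: subDsetl.
(* Each [y], in [A] or not, lies in the member indexed by [y] itself, whose complement omits [y]. *)
- rewrite -subTset => y _; exists (~` (A `\ y)); first by exists y.
  by move=> [_]; apply.
(* Since [D] covers the space, [A] is the finite union of its traces on the members of [D]. *)
rewrite -(setIT A) -DT setI_bigcupr; apply: bigcup_finite => // U /DC[x _ <-].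
apply: (@sub_finite_set _ _ [set x]); last exact: finite_set1.
by move=> z [Az nAxz]; apply: contrapT => zx; apply: nAxz.
Qed.
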